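(* Let $n\geq 1$ and $h$ be integers with $0\leq h\leq n-1$, and let $G_n\in HL_n$ be any $n$-dimensional hypercube-like graph. Then the $h$-super edge-connectivity of $G_n$ exists and $$\lambda_s^{(h)}(G_n)=2^h(n-h).$$
   Context: Graphs are finite, simple and undirected. $\delta(G)$ denotes the minimum degree of a graph $G$ (a single vertex has minimum degree $0$). Operation $\oplus$: let $G_0=(V_0,E_0)$ and $G_1=(V_1,E_1)$ be two disjoint graphs of the same order and $\sigma:V_0\to V_1$ a bijection. Put $M_\sigma=\{x\sigma(x) : x\in V_0\}$ and let $G_0\oplus G_1$ denote the graph $(V_0\cup V_1,\,E_0\cup E_1\cup M_\sigma)$. Different choices of $\sigma$ may give different graphs; any of them is denoted $G_0\oplus G_1$. Hypercube-like graphs: the sets $HL_n$ ($n\geq 0$) are defined recursively (graphs being considered up to isomorphism, so that disjoint copies can be taken). $HL_0=\{K_1\}$; and $G_n\in HL_n$ for $n\geq 1$ if and only if $G_n=G_{n-1}\oplus G'_{n-1}$ for some $G_{n-1},G'_{n-1}\in HL_{n-1}$ and some bijection $\sigma$ between their vertex sets. $h$-super edge-connectivity: for an integer $h\geq 0$ and a connected graph $G=(V,E)$, a set $F\subseteq E$ is an $h$-edge-cut of $G$ if $G-F$ (the graph on all of $V$ with edge set $E\setminus F$) is disconnected and $\delta(G-F)\geq h$. The $h$-super edge-connectivity $\lambda_s^{(h)}(G)$ is the minimum cardinality of an $h$-edge-cut of $G$; it exists if $G$ has at least one $h$-edge-cut. *)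

(* Defs.v *)
From HB Require Import structures.
From mathcomp Require Import all_boot.
Set Implicit Arguments.
Unset Strict Implicit.
Unset Printing Implicit Defensive.

Record sgraph := SGraph {
  vertex :> finType;
  adj : rel vertex;
  adj_sym : symmetric adj;
  adj_irrefl : irreflexive adj
}.

Definition iso (G H : sgraph) : Prop :=
  exists2 f : G -> H, bijective f & forall x y, adj (f x) (f y) = adj x y.

Definition edges (G : sgraph) : {set {set G}} :=
  [set [set p.1; p.2] | p : G * G & adj p.1 p.2].

Definition degree (G : sgraph) (x : G) : nat := #|[set y | adj x y]|.

(* Every degree is < #|G|, so for a nonempty graph the initial value #|G|
   does not affect the minimum. *)
Definition min_degree (G : sgraph) : nat :=
  \big[minn/#|G|]_(x : G) degree x.

Definition connected (G : sgraph) : bool :=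
  [forall x : G, forall y : G, connect (@adj G) x y].

Section DeleteEdges.
Variables (G : sgraph) (F : {set {set G}}).

Definition del_adj : rel G :=
  fun x y => adj x y && ([set x; y] \notin F).

Lemma del_adj_sym : symmetric del_adj.
Proof. by move=> x y; rewrite /del_adj adj_sym setUC. Qed.

Lemma del_adj_irrefl : irreflexive del_adj.
Proof. by move=> x; rewrite /del_adj adj_irrefl. Qed.

Definition del_edges : sgraph := SGraph del_adj_sym del_adj_irrefl.
End DeleteEdges.

Section Oplus.
Variables (G0 G1 : sgraph) (sigma : G0 -> G1).

Definition oplus_adj : rel (G0 + G1)%type := fun u v =>
  match u, v with
  | inl x, inl y => adj x y
  | inr x, inr y => adj x y
  | inl x, inr y => sigma x == y
  | inr y, inl x => sigma x == y
  end.

Lemma oplus_adj_sym : symmetric oplus_adj.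
Proof. by move=> [x|x] [y|y] //=; apply: adj_sym. Qed.

Lemma oplus_adj_irrefl : irreflexive oplus_adj.
Proof. by move=> [x|x] /=; apply: adj_irrefl. Qed.

(* Disjointness of the two vertex sets is provided by the sum type; sigma is
   required to be bijective where oplus is used. *)
Definition oplus : sgraph := SGraph oplus_adj_sym oplus_adj_irrefl.
End Oplus.

Lemma K1_adj_sym : symmetric (fun _ _ : unit => false).
Proof. by []. Qed.

Lemma K1_adj_irrefl : irreflexive (fun _ _ : unit => false).
Proof. by []. Qed.

Definition K1 : sgraph := SGraph K1_adj_sym K1_adj_irrefl.

(* Each clause is closed under isomorphism, so HL n is a class of graphs up to
   isomorphism. *)
Inductive HL : nat -> sgraph -> Prop :=
| HL_zero (G : sgraph) : iso K1 G -> HL 0 G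
| HL_succ (n : nat) (G0 G1 : sgraph) (sigma : G0 -> G1) (G : sgraph) :
    HL n G0 -> HL n G1 -> bijective sigma -> iso (oplus sigma) G ->
    HL n.+1 G.

(* The notion is only defined for connected G, hence the first conjunct. *)
Definition h_edge_cut (G : sgraph) (h : nat) (F : {set {set G}}) : bool :=
  [&& connected G, F \subset edges G, ~~ connected (del_edges F)
    & h <= min_degree (del_edges F)].

Definition has_h_edge_cut (G : sgraph) (h : nat) : Prop :=
  exists F : {set {set G}}, h_edge_cut h F.

Lemma h_edge_cut_card (G : sgraph) (h : nat) : has_h_edge_cut G h ->
  exists k : nat, [exists F : {set {set G}}, h_edge_cut h F && (#|F| == k)].
Proof.
by move=> [F cutF]; exists #|F|; apply/existsP; exists F; rewrite cutF eqxx.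
Qed.

Definition super_edge_connectivity (G : sgraph) (h : nat)
    (exF : has_h_edge_cut G h) : nat :=
  ex_minn (h_edge_cut_card exF).

(* Main.v *)
Require Import Defs.
From HB Require Import structures.
From mathcomp Require Import all_boot.
From mathcomp Require Import zify.

Set Implicit Arguments.
Unset Strict Implicit.
Unset Printing Implicit Defensive.

(** An h-edge-cut F splits the graph into a union X of components of G - F and
its complement, every vertex keeping at least h neighbours on its own side,
and F contains all edges between X and ~: X; those edges alone are already an
h-edge-cut. So the quantity to minimise
is [cut X], the number of edges leaving X, over the sets X such that X and ~: X
are nonempty and both induce minimum degree at least h.

Upper bound. A subcube X of dimension h, obtained by going n - h times into the
left half, is h-regular, so each of its 2^h vertices sends n - h edges outside.
A vertex outside X was separated from X at one of the halvings, and only the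
perfect matching used there can join it to X: it has at most one neighbour in
X and keeps degree at least n - 1 ([HL_subcube], [HL_cut_exists]).

Lower bound. The inequality 2^h (n - h) <= cut X goes by induction on n
([HL_cut_bound]). If X and ~: X both meet both halves, passing to a half costs
a vertex at most its one matching edge, so the induction hypothesis applies to
each half with h - 1, and the two bounds 2^(h-1) (n - h) add up. Otherwise, up
to complement, X lies in one half; then its matching edges all leave X, so
that its cut is the cut inside that half plus #|X|. The complement of X inside
that half may have lost degree, so the induction hypothesis is of no use there.
What is needed is a bound on the cut plus #|X| under a degree condition on X
alone, namely 2^h (n + 1 - h) <= cut X + #|X| ([HL_dense_set]), whose own
induction on n is straightforward.

For h = 0 the lower bound says that no proper nonempty X has an empty cut;
this is how G itself is seen to be connected. *)

(** * Edge cuts and degrees inside a vertex set *)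

Section Cuts.
Variable G : sgraph.
Implicit Types (X : {set G}) (x y : G).

Definition degree_in X x := \sum_(y in X) (adj x y : nat).

(** Each crossing edge is counted once, from its end in [X]. *)
Definition cut X := \sum_(x in X) degree_in (~: X) x.

Definition inner_degree_ge h X := forall x, x \in X -> h <= degree_in X x.

Lemma degree_in_card X x : degree_in X x = #|[set y in X | adj x y]|.
Proof. by rewrite /degree_in -sum1dep_card -big_mkcondr. Qed.

Lemma degree_in_setT x : degree_in setT x = degree x.
Proof. by rewrite degree_in_card; apply: eq_card => y; rewrite !inE. Qed.

Lemma degree_inC X x : degree_in X x + degree_in (~: X) x = degree x.
Proof.
rewrite -degree_in_setT /degree_in [RHS](bigID (mem X)) /=.
by congr (_ + _); apply: eq_bigl => y; rewrite !inE.
Qed.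

Lemma cutC X : cut (~: X) = cut X.
Proof.
rewrite /cut /degree_in setCK exchange_big; apply: eq_bigr => x _.
by apply: eq_bigr => y _; rewrite adj_sym.
Qed.

Lemma cut0 : cut set0 = 0.
Proof. by rewrite /cut big_set0. Qed.

Definition cut_pairs X : {set G * G} :=
  [set p | [&& p.1 \in X, p.2 \notin X & adj p.1 p.2]].

Lemma card_cut_pairs X : #|cut_pairs X| = cut X.
Proof.
rewrite /cut /degree_in pair_big_dep /= -sum1_card.
rewrite [LHS]big_mkcond [RHS]big_mkcond; apply: eq_bigr => -[x y] _ /=.
by rewrite !inE /=; case: (x \in X); case: (y \in X); case: (adj x y).
Qed.

Definition cut_edges X : {set {set G}} :=
  [set [set p.1; p.2] | p in cut_pairs X].

(** One end in [X] is enough to recognise a cut edge, since the ends of a cut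
edge lie on opposite sides. *)
Lemma cut_edgesP X x y : x \in X -> adj x y ->
  ([set x; y] \in cut_edges X) = (y \notin X).
Proof.
move=> Xx xy; apply/imsetP/idP => [[[u v]]|Yy]; last first.
  by exists (x, y) => //; rewrite inE /= Xx Yy.
rewrite inE /= => /and3P[Xu Xv _] E.
have := set22 u v; rewrite -E !inE => /orP[/eqP vx | /eqP vy].
  by rewrite vx Xx in Xv.
by rewrite -vy.
Qed.

Lemma cut_edges_sub X : cut_edges X \subset edges G.
Proof.
by apply: imsetS; apply/subsetP => p; rewrite !inE => /and3P[].
Qed.

Lemma cut_edgesC X : cut_edges (~: X) = cut_edges X.
Proof.
apply/setP => e; apply/imsetP/imsetP => -[[x y]]; rewrite !inE /= => /and3P[Xx Xy xy] ->;
  by exists (y, x); rewrite ?inE /= ?Xy ?Xx ?(negbNE Xy) ?(adj_sym y) //= setUC.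
Qed.

(** Sending a crossing pair to the underlying edge is injective: the end in [X]
comes first. *)
Lemma card_cut_edges X : #|cut_edges X| = cut X.
Proof.
rewrite -card_cut_pairs card_in_imset // => -[x y] [u v]; rewrite !inE /=.
move=> /and3P[Xx Xy _] /and3P[Xu Xv _] E.
have := set21 x y; have := set22 x y.
rewrite E !inE => /orP[] /eqP yE /orP[] /eqP xE; subst=> //.
- by rewrite Xu in Xy.
- by rewrite Xu in Xy.
- by rewrite Xx in Xv.
Qed.

(** The component of a vertex that does not reach everything is such an [X];
conversely a set with no leaving edge is closed under adjacency. *)
Lemma connectedPn : reflect (exists X, [/\ X != set0, ~: X != set0 & cut X = 0])
  (~~ connected G).
Proof.
apply: (iffP idP) => [|[X [/set0Pn[x Xx] /set0Pn[y]]]].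
  rewrite negb_forall => /existsP[x]; rewrite negb_forall => /existsP[y xy].
  exists [set z | connect (@adj G) x z]; split.
  - by apply/set0Pn; exists x; rewrite inE.
  - by apply/set0Pn; exists y; rewrite !inE.
  rewrite -card_cut_pairs; apply: eq_card0 => -[u v]; rewrite !inE /=.
  apply/negP => /and3P[xu /negP xv uv]; apply: xv.
  exact: connect_trans xu (connect1 uv).
rewrite inE => Xy /eqP; rewrite -card_cut_pairs cards_eq0 => /eqP cut0.
apply/negP => /forallP/(_ x)/forallP/(_ y) xy.
have clX : closed (@adj G) X.
  apply: intro_closed; first exact/sym_connect_sym/adj_sym.
  move=> u v uv Xu; apply: contraT => Xv.
  by have := in_set0 (u, v); rewrite -cut0 inE /= Xu Xv uv.
by move: Xy; rewrite -(closed_connect clX xy) Xx.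
Qed.

Lemma min_degree_leq x : min_degree G <= degree x.
Proof.
rewrite /min_degree; have := mem_index_enum x.
elim: (index_enum _) => //= y s IHs; rewrite inE big_cons geq_min.
by case/predU1P => [<-|/IHs ->]; rewrite ?leqnn ?orbT.
Qed.

(** The vertex [x0] makes the initial value #|G| of the minimum harmless: it
exceeds the degree of [x0]. *)
Lemma leq_min_degree h x0 : (forall x, h <= degree x) -> h <= min_degree G.
Proof.
move=> hdeg; apply: (big_ind (leq h)) => [|a b ha hb|x _] //.
  exact: leq_trans (hdeg x0) (max_card _).
by rewrite leq_min ha.
Qed.

End Cuts.

(** * Halves of a graph isomorphic to a matching sum *)

(** [G] is seen through an isomorphism [f] from [oplus s], which splits every
vertex set, and then its degrees and cuts, into parts in [G0] and [G1]. *)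
Section Doubling.
Variables (G G0 G1 : sgraph) (s : G0 -> G1) (f : oplus s -> G).
Hypotheses (s_bij : bijective s) (f_bij : bijective f).
Hypothesis f_adj : forall u v, adj (f u) (f v) = adj u v.
Implicit Type X : {set G}.

Definition left_half X : {set G0} := [set x | f (inl x) \in X].
Definition right_half X : {set G1} := [set x | f (inr x) \in X].

Lemma sum_halves X (F : G -> nat) :
  \sum_(z in X) F z = \sum_(x in left_half X) F (f (inl x))
                    + \sum_(x in right_half X) F (f (inr x)).
Proof.
rewrite (reindex f) /=; last exact: onW_bij.
by rewrite big_sumType /=; congr (_ + _); apply: eq_bigl => x; rewrite inE.
Qed.

Lemma left_halfC X : left_half (~: X) = ~: left_half X.
Proof. by apply/setP => x; rewrite !inE. Qed.

Lemma right_halfC X : right_half (~: X) = ~: right_half X.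
Proof. by apply/setP => x; rewrite !inE. Qed.

Lemma card_halves X : #|X| = #|left_half X| + #|right_half X|.
Proof. by rewrite -!sum1_card sum_halves. Qed.

Lemma halves_onto (A : {set G0}) (B : {set G1}) :
  exists X, left_half X = A /\ right_half X = B.
Proof.
have [g fK gK] := f_bij.
exists [set z | match g z with inl x => x \in A | inr x => x \in B end].
by split; apply/setP => x; rewrite !inE fK.
Qed.

Lemma degree_in_left X x :
  degree_in X (f (inl x)) = degree_in (left_half X) x + (s x \in right_half X).
Proof.
rewrite /degree_in sum_halves; congr (_ + _).
  by apply: eq_bigr => y _; rewrite f_adj.
rewrite big_mkcond (bigD1 (s x)) //= big1 ?addn0 => [|y /negbTE ny].
  by rewrite f_adj /= eqxx; case: ifP.
by rewrite f_adj /= eq_sym ny if_same.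
Qed.

Lemma degree_in_right X x :
  degree_in X (f (inr (s x))) =
    degree_in (right_half X) (s x) + (x \in left_half X).
Proof.
rewrite /degree_in sum_halves addnC; congr (_ + _).
  by apply: eq_bigr => y _; rewrite f_adj.
rewrite big_mkcond (bigD1 x) //= big1 ?addn0 => [|y /negbTE ny].
  by rewrite f_adj /= eqxx; case: ifP.
by rewrite f_adj /= bij_eq // ny if_same.
Qed.

(** An edge leaving [X] stays within a half or is a matching edge with exactly
one end in [X]. *)
Lemma cut_halves X :
  cut X = cut (left_half X) + cut (right_half X)
          + \sum_x ((x \in left_half X) != (s x \in right_half X)).
Proof.
have sum_right (F : G1 -> nat) : \sum_(y in right_half X) F y =
    \sum_(x | s x \in right_half X) F (s x).
  by rewrite (reindex s) //; apply: onW_bij.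
rewrite /cut sum_halves !sum_right.
under eq_bigr do rewrite degree_in_left left_halfC right_halfC.
under [X in _ + X = _]eq_bigr do rewrite degree_in_right left_halfC right_halfC.
rewrite !big_split /= addnACA; congr (_ + _).
rewrite [X in X + _]big_mkcond [X in _ + X]big_mkcond -big_split /=.
apply: eq_bigr => x _; rewrite !(in_setC _ (left_half X), in_setC _ (right_half X)).
by case: (x \in left_half X); case: (s x \in right_half X).
Qed.

Lemma leq_cut_halves X : cut (left_half X) + cut (right_half X) <= cut X.
Proof. by rewrite cut_halves leq_addr. Qed.

Lemma cut_left_only X : right_half X = set0 ->
  cut X = cut (left_half X) + #|left_half X|.
Proof.
move=> X1; rewrite cut_halves X1 cut0 addn0; congr (_ + _).
rewrite -sum1_card [RHS]big_mkcond; apply: eq_bigr => x _.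
by rewrite in_set0; case: (_ \in _).
Qed.

Lemma cut_right_only X : left_half X = set0 ->
  cut X = cut (right_half X) + #|right_half X|.
Proof.
move=> X0; rewrite cut_halves X0 cut0 add0n; congr (_ + _).
rewrite -sum1_card [RHS](reindex s) /=; last exact: onW_bij.
rewrite [RHS]big_mkcond; apply: eq_bigr => x _.
by rewrite in_set0; case: (_ \in _).
Qed.

(** The only neighbour outside the half is the matched vertex, hence the loss
of one. *)
Lemma inner_degree_left h X : inner_degree_ge h X ->
  inner_degree_ge h.-1 (left_half X).
Proof.
move=> hX x; rewrite inE => /hX; rewrite degree_in_left.
by case: (_ \in _); lia.
Qed.

Lemma inner_degree_right h X : inner_degree_ge h X ->
  inner_degree_ge h.-1 (right_half X).
Proof.
have [t sK tK] := s_bij.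
move=> hX y; rewrite inE -[y]tK => /hX; rewrite degree_in_right.
by case: (_ \in _); lia.
Qed.

Lemma inner_degree_left_only h X : right_half X = set0 -> inner_degree_ge h X ->
  inner_degree_ge h (left_half X).
Proof. by move=> X1 hX x; rewrite inE => /hX; rewrite degree_in_left X1 inE addn0. Qed.

Lemma inner_degree_right_only h X : left_half X = set0 -> inner_degree_ge h X ->
  inner_degree_ge h (right_half X).
Proof.
have [t sK tK] := s_bij.
move=> X0 hX y; rewrite inE -[y]tK => /hX.
by rewrite degree_in_right X0 inE addn0.
Qed.

End Doubling.

(** * Hypercube-like graphs: lower bound *)

Lemma HL_regular n (G : sgraph) : HL n G -> forall x : G, degree x = n.
Proof.
elim=> {n G} [G [f [g fK gK] f_adj] x|
  n G0 G1 s G _ IH0 _ IH1 s_bij [f f_bij f_adj] z].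
  rewrite -(gK x) -degree_in_setT degree_in_card; apply: eq_card0 => y.
  by rewrite !inE -(gK y) f_adj.
have [g fK gK] := f_bij; have [t sK tK] := s_bij.
have halfT : (left_half f setT = setT) * (right_half f setT = setT).
  by split; apply/setP => x; rewrite !inE.
rewrite -degree_in_setT -(gK z); case: (g z) => x.
  by rewrite degree_in_left // !halfT degree_in_setT inE IH0 addn1.
by rewrite -(tK x) degree_in_right // !halfT degree_in_setT inE IH1 addn1.
Qed.

Lemma HL_card n (G : sgraph) : HL n G -> #|G| = 2 ^ n.
Proof.
elim=> {n G} [G [f f_bij _]|n G0 G1 s G _ IH0 _ IH1 _ [f f_bij _]].
  by rewrite -(bij_eq_card f_bij) card_unit.
by rewrite -(bij_eq_card f_bij) card_sum IH0 IH1 addnn -mul2n expnS.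
Qed.

Lemma leq_pow2_double_pred h : 2 ^ h <= 2 * 2 ^ h.-1.
Proof. by case: h => //= h; rewrite expnS. Qed.

(** If both parts of [X] are nonempty, the bounds for [h - 1] add up; if [X] lies
in one half, each of its vertices gains an edge leaving [X], so that
#|X| >= 2^h is added. The three bounds are proved together: this last step uses
the second, and the first makes n + 1 - h a true difference. *)
Lemma HL_dense_set n h (G : sgraph) (X : {set G}) : HL n G ->
  X != set0 -> inner_degree_ge h X ->
  [/\ h <= n, 2 ^ h <= #|X| & 2 ^ h * (n.+1 - h) <= cut X + #|X|].
Proof.
move=> HG; elim: HG h X => {n G} [G HG|
  n G0 G1 s G _ IH0 _ IH1 s_bij [f f_bij f_adj]] h X X0 hX.
  have [x Xx] := set0Pn _ X0.
  have := hX x Xx; have := degree_inC X x; rewrite (HL_regular (HL_zero HG)).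
  rewrite -card_gt0 in X0 => deg0 hdeg; have -> : h = 0 by lia.
  by split=> //; lia.
have := leq_cut_halves s_bij f_bij f_adj X.
have cX := card_halves f_bij X.
have [L0|L0] := eqVneq (left_half f X) set0.
  move=> _; rewrite (cut_right_only s_bij f_bij f_adj L0) cX L0 cards0 add0n.
  have [|hn c b] := IH1 h _ _ (inner_degree_right_only s_bij f_bij f_adj L0 hX).
    by apply: contraNneq X0 => R0; rewrite -cards_eq0 cX L0 R0 !cards0.
  split=> //; first exact: leqW.
  by rewrite subSn ?mulnS; lia.
have [R0|R0] := eqVneq (right_half f X) set0.
  move=> _; rewrite (cut_left_only s_bij f_bij f_adj R0) cX R0 cards0 addn0.
  have [//|hn c b] := IH0 h _ _ (inner_degree_left_only f_bij f_adj R0 hX).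
  split=> //; first exact: leqW.
  by rewrite subSn ?mulnS; lia.
have [hn c0 b0] := IH0 _ _ L0 (inner_degree_left f_bij f_adj hX).
have [_ c1 b1] := IH1 _ _ R0 (inner_degree_right s_bij f_bij f_adj hX).
rewrite cX => cutX; split.
- lia.
- have := leq_pow2_double_pred h; lia.
have : 2 ^ h * (n.+2 - h) <= 2 * (2 ^ h.-1 * (n.+1 - h.-1)).
  case: (h) => [|k] /=; last by rewrite expnS mulnA.
  by rewrite !mul1n; lia.
lia.
Qed.

Lemma HL_cut_bound n h (G : sgraph) (X : {set G}) : HL n G ->
  X != set0 -> ~: X != set0 ->
  inner_degree_ge h X -> inner_degree_ge h (~: X) -> 2 ^ h * (n - h) <= cut X.
Proof.
move=> HG; elim: HG h X => {n G} [G HG|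
  n G0 G1 s G HG0 IH0 HG1 IH1 s_bij [f f_bij f_adj]] h X; first by rewrite muln0.
have one_sided Y : Y != set0 -> inner_degree_ge h Y ->
    (left_half f Y == set0) || (right_half f Y == set0) ->
    2 ^ h * (n.+1 - h) <= cut Y.
  move=> Y0 hY /orP[] /eqP H0.
    rewrite (cut_right_only s_bij f_bij f_adj H0).
    have [|_ _ ->] // := HL_dense_set HG1 _ (inner_degree_right_only s_bij f_bij f_adj H0 hY).
    by apply: contraNneq Y0 => R0; rewrite -cards_eq0 (card_halves f_bij) H0 R0 !cards0.
  rewrite (cut_left_only s_bij f_bij f_adj H0).
  have [|_ _ ->] // := HL_dense_set HG0 _ (inner_degree_left_only f_bij f_adj H0 hY).
  by apply: contraNneq Y0 => R0; rewrite -cards_eq0 (card_halves f_bij) H0 R0 !cards0.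
move=> X0 Xc0 hX hXc.
have [/(one_sided X X0 hX) //|] :=
  boolP ((left_half f X == set0) || (right_half f X == set0)).
have [|] := boolP ((left_half f (~: X) == set0) || (right_half f (~: X) == set0)).
  by move=> /(one_sided _ Xc0 hXc); rewrite cutC.
rewrite !negb_or => /andP[Lc Rc] /andP[L R].
have hLc := inner_degree_left f_bij f_adj hXc.
have hRc := inner_degree_right s_bij f_bij f_adj hXc.
rewrite left_halfC right_halfC in Lc Rc hLc hRc.
have b0 := IH0 _ _ L Lc (inner_degree_left f_bij f_adj hX) hLc.
have b1 := IH1 _ _ R Rc (inner_degree_right s_bij f_bij f_adj hX) hRc.
have cutX := leq_cut_halves s_bij f_bij f_adj X.
have : 2 ^ h * (n.+1 - h) <= 2 * (2 ^ h.-1 * (n - h.-1)).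
  case: (h) => [|k] /=; last by rewrite expnS mulnA.
  (* For h = 0 this is n + 1 <= 2n, false only at n = 0; but there G0 is a
     single vertex and could not contain both X and non-X vertices. *)
  have := HL_card HG0; rewrite -cardsT -(setUCr (left_half f X)) cardsU setICr cards0.
  rewrite -!card_gt0 in L Lc.
  by case: (n) => [|m]; rewrite ?expn0; lia.
lia.
Qed.

(** * Hypercube-like graphs: subcubes and the optimal cut *)

(** X is the whole graph if h is its dimension, and is otherwise chosen inside
the left half; the only neighbour that a vertex of the right half can have in it
is then the matched vertex. *)
Lemma HL_subcube n h (G : sgraph) : h <= n -> HL n G ->
  exists X : {set G}, [/\ #|X| = 2 ^ h, forall x, x \in X -> degree_in X x = h
    & forall x, x \notin X -> degree_in X x <= 1].
Proof.
have setT_subcube m (H : sgraph) : HL m H -> exists X : {set H},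
    [/\ #|X| = 2 ^ m, forall x, x \in X -> degree_in X x = m
      & forall x, x \notin X -> degree_in X x <= 1].
  move=> HH; exists setT; split=> [|x _|x]; last by rewrite inE.
    by rewrite cardsT (HL_card HH).
  by rewrite degree_in_setT (HL_regular HH).
move=> hn HG; elim: HG h hn => {n G} [G HG|
  n G0 G1 s G HG0 IH0 HG1 _ s_bij [f f_bij f_adj]] h hn.
  move: hn; rewrite leqn0 => /eqP ->.
  exact: setT_subcube (HL_zero HG).
have [->|hn1] := eqVneq h n.+1.
  have HG : HL n.+1 G by apply: HL_succ HG0 HG1 s_bij _; exists f.
  exact: setT_subcube HG.
have {hn1} hn : h <= n by lia.
have [X0 [cX0 inX0 outX0]] := IH0 h hn.
have [X [LX RX]] := halves_onto f_bij X0 set0.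
have [g fK gK] := f_bij; have [t sK tK] := s_bij.
have memL x : (f (inl x) \in X) = (x \in X0) by rewrite -LX inE.
have memR x : (f (inr x) \in X) = false by rewrite -[RHS](in_set0 x) -RX inE.
exists X; split=> [|z|z]; first by rewrite (card_halves f_bij) LX RX cards0 addn0.
  rewrite -(gK z); case: (g z) => x; last by rewrite memR.
  by rewrite memL degree_in_left // LX RX inE addn0 => /inX0.
rewrite -(gK z); case: (g z) => x.
  by rewrite memL degree_in_left // LX RX inE addn0 => /outX0.
rewrite -(tK x) degree_in_right // LX RX.
by rewrite {1}/degree_in big_set0 leq_b1.
Qed.

Lemma HL_connected n (G : sgraph) : 0 < n -> HL n G -> connected G.
Proof.
move=> n_gt0 HG; apply/negPn/connectedPn => -[X [X0 Xc0 cX0]].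
have := @HL_cut_bound n 0 G X HG X0 Xc0 (fun _ _ => leq0n _) (fun _ _ => leq0n _).
by lia.
Qed.

(** The degrees of G - F within a union X of its components bound the degrees
of G within X from below, and all edges of G leaving X lie in F. *)
Lemma HL_cut_lower n h (G : sgraph) (F : {set {set G}}) : HL n G ->
  h_edge_cut h F -> 2 ^ h * (n - h) <= #|F|.
Proof.
move=> HG /and4P[_ _ /connectedPn[X [X0 Xc0 cX0]] hmin].
have deg_le (Y : {set G}) (x : G) : @degree_in (del_edges F) Y x <= degree_in Y x.
  by apply: leq_sum => y _; rewrite /= /del_adj; case: (@adj G x y); rewrite ?leq_b1.
have inner (Y : {set G}) : @cut (del_edges F) Y = 0 -> inner_degree_ge h Y.
  move=> cY0 x Yx; apply: leq_trans (deg_le Y x).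
  apply: leq_trans hmin _; apply: leq_trans (min_degree_leq (x : del_edges F)) _.
  rewrite -(@degree_inC (del_edges F) Y x); move/eqP: cY0; rewrite sum_nat_eq0.
  by move=> /forall_inP/(_ x Yx)/eqP ->; rewrite addn0.
apply: leq_trans (HL_cut_bound HG X0 Xc0 (inner _ cX0) _) _.
  by apply: inner; rewrite cutC.
rewrite -card_cut_edges; apply/subset_leq_card/subsetP => e /imsetP[[x y]].
rewrite inE /= => /and3P[Xx Xy xy] ->; apply: contraT => xyF.
move/eqP: cX0; rewrite -card_cut_pairs cards_eq0 => /eqP/setP/(_ (x, y)).
by rewrite !inE /= Xx Xy /del_adj xy xyF.
Qed.

Lemma HL_cut_exists n h (G : sgraph) : h < n -> HL n G ->
  exists F : {set {set G}}, h_edge_cut h F && (#|F| == 2 ^ h * (n - h)).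
Proof.
move=> hn HG; have [X [cX inX outX]] := HL_subcube (ltnW hn) HG.
have X0 : X != set0 by rewrite -card_gt0 cX expn_gt0.
have Xc0 : ~: X != set0.
  rewrite -card_gt0; have := cardsC X; rewrite (HL_card HG) cX.
  by have := ltn_exp2l h n (isT : 1 < 2); rewrite hn; lia.
have [x0 _] := set0Pn _ X0.
have degE x : degree_in X x + degree_in (~: X) x = n.
  by rewrite degree_inC (HL_regular HG).
exists (cut_edges X); apply/andP; split; last first.
  rewrite card_cut_edges /cut (eq_bigr (fun=> n - h)) => [|x Xx].
    by rewrite sum_nat_const cX.
  by rewrite -(degE x) inX // addKn.
rewrite /h_edge_cut (HL_connected _ HG) ?(leq_trans _ hn) // cut_edges_sub /=.
(* Deleting the cut edges leaves untouched the edges inside either side, so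
   a vertex keeps at least its neighbours on its own side. *)
have del_same (Y : {set G}) x : x \in Y -> cut_edges Y = cut_edges X ->
    degree_in Y x <= degree (x : del_edges (cut_edges X)).
  move=> Yx <-; rewrite degree_in_card; apply/subset_leq_card/subsetP => y.
  by rewrite !inE /= /del_adj => /andP[Yy xy]; rewrite xy cut_edgesP // Yy.
apply/andP; split.
  apply/connectedPn; exists X; split=> //.
  rewrite -card_cut_pairs; apply: eq_card0 => -[x y]; rewrite !inE /= /del_adj.
  apply/negP => /and3P[Xx Xy /andP[xy]].
  by rewrite cut_edgesP // Xy.
apply: (leq_min_degree (x0 : del_edges (cut_edges X))) => x.
have [Xx|Xx] := boolP (x \in X).
  by rewrite -(inX x Xx); apply: del_same.
apply: leq_trans (del_same (~: X) x _ (cut_edgesC X)); last by rewrite inE.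
by have := outX x Xx; have := degE x; lia.
Qed.

Theorem theorem3p5 (n h : nat) (hn : 1 <= n) (hh : h <= n - 1)
    (G : sgraph) (hG : HL n G) :
  exists exF : has_h_edge_cut G h,
    super_edge_connectivity exF = 2 ^ h * (n - h).
Proof.
have ltn_hn : h < n by lia.
have [F cutF] := HL_cut_exists ltn_hn hG; have /andP[cut_F _] := cutF.
exists (ex_intro _ F cut_F); rewrite /super_edge_connectivity.
case: ex_minnP => k /existsP[F' /andP[cutF' /eqP <-]] k_min.
apply/eqP; rewrite eqn_leq (HL_cut_lower hG cutF') andbT.
by apply: k_min; apply/existsP; exists F.
Qed.
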